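(* Let $\bar\xi=\sum_{d=1}^S w_d\bar\xi_d$ be an invariant design with $h_r(\bar\xi)>0$ for $r=1,2,3$ (so that $\mathbf{M}(\bar\xi)$ is nonsingular). Then the variance function $V((\mathbf{i},\mathbf{j}),\bar\xi)=(\mathbf{f}(\mathbf{i})-\mathbf{f}(\mathbf{j}))^\top\mathbf{M}(\bar\xi)^{-1}(\mathbf{f}(\mathbf{i})-\mathbf{f}(\mathbf{j}))$ is constant on each $\mathcal{X}^{(S)}_d$, and its value $V(d,\bar\xi)$ on $\mathcal{X}^{(S)}_d$ is $$V(d,\bar\xi)=d(v-1)\Big(\frac{1}{h_1(\bar\xi)}+\frac{v-1}{4v\,h_2(\bar\xi)}(2Sv-2S-dv-v+2)+\frac{(v-1)^2}{24v^2h_3(\bar\xi)}\lambda(d)\Big).$$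
   Context: Fix integers $v\ge 2$, $K\ge 3$ and $S$ with $3\le S\le K$. Let $\mathbf{e}_i$ denote the $i$th unit vector of $\mathbb{R}^{v-1}$ and $\mathbf{1}_{v-1}$ the all-ones vector. Define $\mathbf{f}_1:\{0,1,\dots,v\}\to\mathbb{R}^{v-1}$ by $\mathbf{f}_1(i)=\mathbf{e}_i$ for $1\le i\le v-1$, $\mathbf{f}_1(v)=-\mathbf{1}_{v-1}$, $\mathbf{f}_1(0)=\mathbf{0}$. For $\mathbf{i}\in\{0,\dots,v\}^K$ let $\mathbf{f}(\mathbf{i})\in\mathbb{R}^p$ stack $\mathbf{f}_1(i_k)$ ($k=1,\dots,K$), then $\mathbf{f}_1(i_k)\otimes\mathbf{f}_1(i_\ell)$ ($k<\ell$, lexicographic), then $\mathbf{f}_1(i_k)\otimes\mathbf{f}_1(i_\ell)\otimes\mathbf{f}_1(i_m)$ ($k<\ell<m$, lexicographic); $p=K(v-1)+\binom K2(v-1)^2+\binom K3(v-1)^3$. The design region $\mathcal{X}^{(S)}$ is the set of ordered pairs $(\mathbf{i},\mathbf{j})$ in $\{0,\dots,v\}^K$ for which there is a set $A$ of exactly $S$ attributes with $i_k,j_k\in\{1,\dots,v\}$ for $k\in A$ and $i_k=j_k=0$ for $k\notin A$; $\mathcal{X}^{(S)}_d$ is the subset with $i_k\ne j_k$ for exactly $d$ indices $k$. An approximate design is a finitely supported probability measure $\xi$ on $\mathcal{X}^{(S)}$ with information matrix $\mathbf{M}(\xi)=\sum\xi(\mathbf{i},\mathbf{j})(\mathbf{f}(\mathbf{i})-\mathbf{f}(\mathbf{j}))(\mathbf{f}(\mathbf{i})-\mathbf{f}(\mathbf{j}))^\top$;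 $\bar\xi_d$ is the uniform design on $\mathcal{X}^{(S)}_d$, and a design of the form $\sum_{d=1}^S w_d\bar\xi_d$ ($w_d\ge0$, $\sum w_d=1$) is called invariant. Define $\lambda(d)=3S^2+3S^2v^2-6S^2v-3Sdv^2+3Sdv-6Sv^2+15Sv-9S+d^2v^2+3dv^2-6dv+2v^2-6v+6$, $h_1(d)=d/K$, $h_2(d)=\frac{d}{2vK(K-1)}(2Sv-2S-dv-v+2)$, $h_3(d)=\frac{d\lambda(d)}{4v^2K(K-1)(K-2)}$, and $h_r(\bar\xi)=\sum_{d=1}^S w_d h_r(d)$. *)

(* Defs.v *)
From HB Require Import structures.
From mathcomp Require Import all_boot all_order all_algebra.
Set Implicit Arguments. Unset Strict Implicit. Unset Printing Implicit Defensive.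
Import Order.TTheory GRing.Theory Num.Theory.
Local Open Scope ring_scope.

Notation prof K v := {ffun 'I_K -> 'I_v.+1}.
Notation pt K v := (prof K v * prof K v)%type.

(* f_1 : {0..v} -> R^{v-1}; coordinate a (0-based, a : 'I_(v-1)). *)
Definition f1 (R : ringType) (v : nat) (i : 'I_v.+1) (a : 'I_v.-1) : R :=
  if (val i == v)%N then -1 else ((val i == a.+1)%N)%:R.

(* Coordinates of f: main effects (k,a); two-factor (k<l,a,b); three-factor (k<l<m,a,b,c). *)
Notation idx1 K v := ('I_K * 'I_v.-1)%type.
Notation idx2 K v :=
  {x : ('I_K * 'I_K) * ('I_v.-1 * 'I_v.-1) | (x.1.1 < x.1.2)%N}.
Notation idx3 K v :=
  {x : ('I_K * 'I_K * 'I_K) * ('I_v.-1 * 'I_v.-1 * 'I_v.-1)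
     | (x.1.1.1 < x.1.1.2 < x.1.2)%N}.
Notation idx K v := (idx1 K v + (idx2 K v + idx3 K v))%type.

Definition feat (R : ringType) (K v : nat) (i : prof K v) (r : idx K v) : R :=
  match r with
  | inl (k, a) => f1 R (i k) a
  | inr (inl y) =>
      let: ((k, l), (a, b)) := val y in f1 R (i k) a * f1 R (i l) b
  | inr (inr z) =>
      let: ((k, l, m), (a, b, c)) := val z in
      f1 R (i k) a * f1 R (i l) b * f1 R (i m) c
  end.

Definition fvec (R : ringType) (K v : nat) (i : prof K v) : 'cV[R]_#|{: idx K v}| :=
  \col_r feat R i (enum_val r).

Definition dvec (R : ringType) (K v : nat) (x : pt K v) : 'cV[R]_#|{: idx K v}| :=
  fvec R x.1 - fvec R x.2.

Definition inXS (K v S : nat) (x : pt K v) : bool :=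
  [exists A : {set 'I_K}, (#|A| == S) &&
     [forall k, if k \in A then (val (x.1 k) != 0%N) && (val (x.2 k) != 0%N)
                else (val (x.1 k) == 0%N) && (val (x.2 k) == 0%N)]].

Definition inXSd (K v S d : nat) (x : pt K v) : bool :=
  inXS S x && (#|[set k | x.1 k != x.2 k]| == d).

Definition infomx (R : fieldType) (K v : nat) (xi : pt K v -> R)
  : 'M[R]_#|{: idx K v}| :=
  \sum_(x : pt K v) xi x *: (dvec R x *m (dvec R x)^T).

Definition unif (R : fieldType) (K v S d : nat) (x : pt K v) : R :=
  if inXSd S d x then (#|[pred y : pt K v | inXSd S d y]|%:R)^-1 else 0.

Definition invdes (R : fieldType) (K v S : nat) (w : nat -> R) (x : pt K v) : R :=
  \sum_(1 <= d < S.+1) w d * unif R S d x.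

Definition varf (R : fieldType) (K v : nat) (xi : pt K v -> R) (x : pt K v) : R :=
  ((dvec R x)^T *m invmx (infomx xi) *m dvec R x) 0 0.

Definition lam (R : fieldType) (v S d : nat) : R :=
  let S := S%:R in let v := v%:R in let d := d%:R in
  3 * S ^+ 2 + 3 * S ^+ 2 * v ^+ 2 - 6 * S ^+ 2 * v - 3 * S * d * v ^+ 2
  + 3 * S * d * v - 6 * S * v ^+ 2 + 15 * S * v - 9 * S + d ^+ 2 * v ^+ 2
  + 3 * d * v ^+ 2 - 6 * d * v + 2 * v ^+ 2 - 6 * v + 6.

Definition h1 (R : fieldType) (K d : nat) : R := d%:R / K%:R.
Definition h2 (R : fieldType) (K v S d : nat) : R :=
  d%:R / (2 * v%:R * K%:R * (K%:R - 1))
  * (2 * S%:R * v%:R - 2 * S%:R - d%:R * v%:R - v%:R + 2).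
Definition h3 (R : fieldType) (K v S d : nat) : R :=
  d%:R * lam R v S d / (4 * v%:R ^+ 2 * K%:R * (K%:R - 1) * (K%:R - 2)).

Definition hdes (R : fieldType) (S : nat) (w : nat -> R) (h : nat -> R) : R :=
  \sum_(1 <= d < S.+1) w d * h d.

Definition Vformula (R : fieldType) (K v S : nat) (w : nat -> R) (d : nat) : R :=
  d%:R * (v%:R - 1) *
  ( (hdes S w (h1 R K))^-1
  + (v%:R - 1) / (4 * v%:R * hdes S w (h2 R K v S))
      * (2 * S%:R * v%:R - 2 * S%:R - d%:R * v%:R - v%:R + 2)
  + (v%:R - 1) ^+ 2 / (24 * v%:R ^+ 2 * hdes S w (h3 R K v S)) * lam R v S d ).

(* Main.v *)
Require Import Defs.
From HB Require Import structures.
From mathcomp Require Import all_boot all_order all_algebra.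
From mathcomp Require Import fingroup perm ring.
Import Order.TTheory GRing.Theory Num.Theory.
Local Open Scope ring_scope.

(* Each index of the model is encoded by a map e assigning to every attribute
   either nothing or a level parameter, so that a coordinate of f is a product
   over attributes of one-attribute factors.  An invariant design depends on a
   pair only through its attributewise pattern (zero or not, equal or not);
   averaging over a fixed pattern factorises and gives, with G = I + J the Gram
   matrix of f_1, the block M(e,e') = g_B prod_k G(e_k,e'_k) when e and e' have the
   same support B, and 0 otherwise.  Hence M^-1 is explicit, and since
   f_1(i)^T G^-1 f_1(j) = [i = j] - 1/v, the variance function is
   sum_B q_B(x) / g_B with q_B a combination of products of this kernel.  Both g_B
   and the sums of q_B over the B of given size are elementary symmetric functions
   of S kernel values, evaluated by Newton's identities. *)

Lemma sum_option (V : nmodType) (T : finType) (F : option T -> V) :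
  \sum_a F a = F None + \sum_b F (Some b).
Proof.
rewrite (bigD1 None) //=; congr (_ + _).
rewrite (reindex_omap Some id) /=; last by case.
by apply: eq_bigl => b; rewrite eqxx.
Qed.

(** * Moments of the coding of one attribute *)

Section Levels.
Variables (R : realFieldType) (v : nat).
Hypothesis hv : (2 <= v)%N.
Local Notation lev := 'I_v.+1.
Local Notation par := 'I_v.-1.

(* [None] stands for an attribute absent from the term. *)
Definition f1x (i : lev) (a : option par) : R :=
  if a is Some b then f1 R i b else 1.

(** Second moments of the coding bordered by the constant 1, up to the normalisation carried by
    [kapx]. The mixed entries vanish because every coordinate of [f1] sums to zero over the levels;
    two present parameters give I + J. *)
Definition gram (a b : option par) : R :=
  match a, b with
  | Some c, Some d => (c == d)%:R + 1
  | None, None => 1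
  | _, _ => 0
  end.

(** For order v - 1 the inverse of I + J is I - J/v. *)
Definition gram_inv (a b : option par) : R :=
  match a, b with
  | Some c, Some d => (c == d)%:R - v%:R^-1
  | None, None => 1
  | _, _ => 0
  end.

(** The kernel f_1(i)^T (I + J)^-1 f_1(j); level 0 is set apart because f_1(0) = 0. *)
Definition kap (i j : lev) : R :=
  if (i == ord0) || (j == ord0) then 0 else (i == j)%:R - v%:R^-1.

(** For a present attribute the division makes the diagonal total 1, since [kap i i] sums to v - 1.
    Only the presence of the attribute matters here; the actual parameters enter through [gram]. *)
Definition kapx (a : option par) (i j : lev) : R :=
  if a is Some _ then kap i j / (v%:R - 1) else 1.

Lemma v_neq0 : v%:R != 0 :> R. Proof. by rewrite pnatr_eq0; case: v hv. Qed.

Lemma predv : v.-1%:R = v%:R - 1 :> R.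
Proof. by case: v hv => // n _; rewrite /= -natr1 addrK. Qed.

Lemma v1_neq0 : v%:R - 1 != 0 :> R.
Proof. by rewrite -predv pnatr_eq0; case: v hv => [|[]]. Qed.

Lemma sum_par_const (x : R) : \sum_(a : par) x = x * (v%:R - 1).
Proof. by rewrite sumr_const card_ord -predv -(mulr_natr x). Qed.

Lemma sum_lev_const (x : R) : \sum_(i : lev | i != ord0) x = x * v%:R.
Proof.
rewrite sumr_const -(mulr_natr x) -[#|_|]/(#|predC1 (ord0 : lev)|).
by rewrite cardC1 card_ord.
Qed.

Lemma par_ltn (a : par) : (a.+1 < v)%N.
Proof. by rewrite -ltn_predRL. Qed.

Lemma f1_0 (a : par) : f1 R (ord0 : lev) a = 0.
Proof. by rewrite /f1 /=; case: eqP hv => [<-|]. Qed.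

(** The only nonzero values of a coordinate are 1 at level a + 1 and -1 at level v, so a sum against
    it collapses to a difference of two values. *)
Lemma f1E (i : lev) (a : par) :
  f1 R i a = (i == inord a.+1)%:R - (i == ord_max)%:R.
Proof.
have ha := par_ltn a.
rewrite /f1 -!(inj_eq val_inj) /= inordK; last by rewrite ltnS ltnW.
case: (eqVneq (i : nat) v) => [->|_] /=; last by rewrite subr0.
by rewrite gtn_eqF // sub0r.
Qed.

Lemma sum_f1_mul (a : par) (F : lev -> R) :
  \sum_i f1 R i a * F i = F (inord a.+1) - F ord_max.
Proof.
under eq_bigr => i _ do rewrite f1E mulrBl.
rewrite sumrB; congr (_ - _).
  rewrite (bigD1 (inord a.+1)) //= eqxx mul1r big1 ?addr0 // => i /negPf ->.
  by rewrite mul0r.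
rewrite (bigD1 ord_max) //= eqxx mul1r big1 ?addr0 // => i /negPf ->.
by rewrite mul0r.
Qed.

Lemma sum_f1 (a : par) : \sum_i f1 R (i : lev) a = 0.
Proof.
transitivity (\sum_i f1 R (i : lev) a * 1); last first.
  by rewrite (sum_f1_mul a (fun=> 1)) subrr.
by apply: eq_bigr => i _; rewrite mulr1.
Qed.

Lemma sum_f1_f1 (a b : par) : \sum_i f1 R (i : lev) a * f1 R i b = (a == b)%:R + 1.
Proof.
rewrite sum_f1_mul !f1E eqxx.
have ha := par_ltn.
have inE (c : par) : (inord c.+1 : lev) = c.+1 :> nat by rewrite inordK // ltnS ltnW.
have mx (c : par) : (inord c.+1 == ord_max :> lev) = false.
  by rewrite -(inj_eq val_inj) /= inE ltn_eqF.
have ii : (inord a.+1 == inord b.+1 :> lev) = (a == b).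
  by rewrite -(inj_eq val_inj) /= !inE eqSS.
by rewrite mx (eq_sym ord_max) mx ii subr0 sub0r opprK.
Qed.

Lemma sum_kap_l (j : lev) : \sum_i kap i j = 0.
Proof.
rewrite /kap; case: (eqVneq j ord0) => [_|j0].
  by rewrite big1 // => i _; rewrite orbT.
rewrite (bigD1 ord0) //= add0r.
under eq_bigr => i i0 do rewrite (negPf i0) /=.
rewrite sumrB (bigD1 j) //= eqxx big1 ?addr0; last first.
  by move=> i /andP[_ /negPf ->].
by rewrite sum_lev_const mulVf ?subrr // v_neq0.
Qed.

Lemma kapC i j : kap i j = kap j i.
Proof. by rewrite /kap orbC (eq_sym i j). Qed.

Lemma sum_kap_r (i : lev) : \sum_j kap i j = 0.
Proof. by rewrite -[RHS](sum_kap_l i); apply: eq_bigr => j _; exact: kapC. Qed.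

Lemma sum_kap_diag : \sum_i kap i i = v%:R - 1.
Proof.
rewrite (bigD1 ord0) //= {1}/kap eqxx add0r.
rewrite (eq_bigr (fun=> 1 - v%:R^-1)); last first.
  by move=> i /negPf i0; rewrite /kap i0 eqxx.
by rewrite sum_lev_const mulrBl mul1r mulVf // v_neq0.
Qed.

Lemma gram_invK (a c : option par) : \sum_b gram a b * gram_inv b c = (a == c)%:R.
Proof.
rewrite sum_option /=; case: a c => [a|] [c|] /=; rewrite ?(mul0r, mulr0, mul1r, add0r).
- rewrite (eq_bigr (fun b => (a == b)%:R * ((b == c)%:R - v%:R^-1)
    + ((b == c)%:R - v%:R^-1))); last by move=> b _; rewrite mulrDl mul1r.
  rewrite big_split /= (bigD1 a) //= eqxx mul1r big1 ?addr0; last first.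
    by move=> b /negPf; rewrite eq_sym => ->; rewrite mul0r.
  rewrite sumrB (bigD1 c) //= eqxx big1 ?addr0; last by move=> b /negPf ->.
  rewrite sum_par_const.
  rewrite (_ : (Some a == Some c) = (a == c)) //.
  by rewrite /=; field; exact: v_neq0.
- by rewrite big1 // => b _; rewrite mulr0.
- by rewrite big1 // => b _; rewrite mul0r.
- by rewrite big1 ?addr0 // => b _; rewrite mulr0.
Qed.

Lemma f1_max (a : par) : f1 R (ord_max : lev) a = -1.
Proof. by rewrite /f1 eqxx. Qed.

Lemma f1_mid (i : lev) : i != ord0 -> i != ord_max ->
  exists c : par, i = inord c.+1 /\ forall a, f1 R i a = (a == c)%:R.
Proof.
move=> i0 im.
have i1 : (0 < i)%N by rewrite lt0n.
have iv : (i < v)%N by rewrite ltn_neqAle -ltnS ltn_ord andbT.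
have hc : (i.-1 < v.-1)%N by rewrite -ltnS !prednK // (leq_trans _ iv).
exists (Ordinal hc); split=> [|a].
  by apply: val_inj; rewrite /= prednK // inord_val.
by rewrite /f1 ltn_eqF // -(inj_eq val_inj) /= eq_sym -{1}(prednK i1) eqSS.
Qed.

(** With I - J/v in the middle, the form is the inner product of f_1(i) and f_1(j) minus s(i)s(j)/v,
    where s is the sum of the coordinates: 0 at level 0, 1 - v at level v and 1 at the other levels.
    The cases for i and j are checked in turn. *)
Lemma sum_f1_gram_inv (i j : lev) :
  \sum_(a : par) f1 R i a * \sum_(b : par) ((a == b)%:R - v%:R^-1) * f1 R j b = kap i j.
Proof.
have inner a : \sum_(b : par) ((a == b)%:R - v%:R^-1) * f1 R j b =
    f1 R j a - v%:R^-1 * \sum_b f1 R j b.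
  under eq_bigr => b _ do rewrite mulrBl.
  rewrite sumrB -mulr_sumr (bigD1 a) //= eqxx mul1r big1 ?addr0 //.
  by move=> b /negPf; rewrite eq_sym => ->; rewrite mul0r.
under eq_bigr => a _ do rewrite inner mulrBr.
rewrite sumrB -mulr_suml /kap.
have s0 : \sum_a f1 R (ord0 : lev) a = 0 by rewrite big1 // => a _; exact: f1_0.
have [->|i0] /= := eqVneq i ord0.
  by rewrite s0 mul0r subr0 big1 // => a _; rewrite f1_0 mul0r.
have [->|j0] /= := eqVneq j ord0.
  by rewrite s0 !mulr0 subr0 big1 // => a _; rewrite f1_0 mulr0.
have sdelta (F : par -> R) c : \sum_a F a * (a == c)%:R = F c.
  rewrite (bigD1 c) //= eqxx mulr1 big1 ?addr0 //.
  by move=> b /negPf ->; rewrite mulr0.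
have sdelta1 (c : par) : \sum_a (a == c)%:R = 1 :> R.
  by rewrite -[RHS](sdelta (fun=> 1) c); apply: eq_bigr => a _; rewrite mul1r.
have smax : \sum_a f1 R (ord_max : lev) a = 1 - v%:R.
  under eq_bigr => a _ do rewrite f1_max.
  by rewrite sum_par_const mulN1r opprB.
have [->|im] := eqVneq i ord_max.
  under eq_bigr => a _ do rewrite f1_max mulN1r.
  rewrite sumrN smax.
  have [->|jm] := eqVneq j ord_max.
    by rewrite smax /=; field; exact: v_neq0.
  have [c [jE fj]] := f1_mid j j0 jm.
  under eq_bigr => a _ do rewrite fj.
  by rewrite sdelta1 /=; field; exact: v_neq0.
have [c [iE fi]] := f1_mid i i0 im.
under eq_bigr => a _ do rewrite fi mulrC.
rewrite sdelta; under eq_bigr => a _ do rewrite fi.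
rewrite sdelta1.
have [->|jm] := eqVneq j ord_max.
  by rewrite smax f1_max (negPf im) /=; field; exact: v_neq0.
have [d [jE fj]] := f1_mid j j0 jm.
under eq_bigr => a _ do rewrite fj.
rewrite sdelta1 fj mul1r mulr1; congr ((nat_of_bool _)%:R - _).
have ha (k : par) : (k.+1 < v.+1)%N by rewrite ltnS ltnW // par_ltn.
by rewrite iE jE -[RHS](inj_eq val_inj) /= !inordK // eqSS.
Qed.

(** * Sums over one pattern of a pair of levels *)

Definition same_sums (F F' : lev * lev -> R) :=
  [/\ F (ord0, ord0) = F' (ord0, ord0),
      \sum_j F (ord0, j) = \sum_j F' (ord0, j),
      \sum_i F (i, ord0) = \sum_i F' (i, ord0),
      \sum_i F (i, i) = \sum_i F' (i, i) &
      \sum_i \sum_j F (i, j) = \sum_i \sum_j F' (i, j)].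

(** Three booleans, of whose eight combinations only five occur, one for each sum in [same_sums]. *)
Definition ptype (p : lev * lev) := (p.1 == ord0, p.2 == ord0, p.1 == p.2).

(** The five unrestricted sums determine the sums over the five patterns by successive subtraction.
    They are easier to evaluate than the restricted ones, because the coding and its kernel sum to
    zero over all levels. *)
Lemma same_sums_ptype (F F' : lev * lev -> R) t : same_sums F F' ->
  \sum_(p | ptype p == t) F p = \sum_(p | ptype p == t) F' p.
Proof.
case=> e00 e0j ei0 eii eij.
pose D p := F p - F' p.
suff : \sum_(p | ptype p == t) D p = 0.
  by rewrite sumrB => /eqP; rewrite subr_eq0 => /eqP.
have d00 : D (ord0, ord0) = 0 by rewrite /D e00 subrr.
have d0j : \sum_j D (ord0, j) = 0 by rewrite sumrB e0j subrr.
have di0 : \sum_i D (i, ord0) = 0 by rewrite sumrB ei0 subrr.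
have dii : \sum_i D (i, i) = 0 by rewrite sumrB eii subrr.
have dij : \sum_i \sum_j D (i, j) = 0.
  rewrite -[RHS](subrr (\sum_i \sum_j F (i, j))) {2}eij -sumrB.
  by apply: eq_bigr => i _; rewrite sumrB.
have d0j' : \sum_(j | j != ord0) D (ord0, j) = 0.
  by move: d0j; rewrite (bigD1 ord0) //= d00 add0r.
have di0' : \sum_(i | i != ord0) D (i, ord0) = 0.
  by move: di0; rewrite (bigD1 ord0) //= d00 add0r.
have dii' : \sum_(i | i != ord0) D (i, i) = 0.
  by move: dii; rewrite (bigD1 ord0) //= d00 add0r.
have dij' : \sum_(i | i != ord0) \sum_(j | j != ord0) D (i, j) = 0.
  move: dij; rewrite (bigD1 ord0) //= d0j add0r.
  rewrite (eq_bigr (fun i => D (i, ord0) + \sum_(j | j != ord0) D (i, j))); last first.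
    by move=> i _; rewrite (bigD1 ord0).
  by rewrite big_split /= di0' add0r.
(* Distinct nonzero levels are what remains of the nonzero square once its diagonal is removed. *)
have dne : \sum_(i | i != ord0) \sum_(j | (j != ord0) && (i != j)) D (i, j) = 0.
  move: dij'; rewrite (eq_bigr (fun i => D (i, i) +
     \sum_(j | (j != ord0) && (i != j)) D (i, j))); last first.
    move=> i i0; rewrite (bigD1 i) //=; congr (_ + _).
    by apply: eq_bigl => j; rewrite (eq_sym i).
  by rewrite big_split /= dii' add0r.
have -> : \sum_(p | ptype p == t) D p =
   \sum_i \sum_(j | ptype (i, j) == t) D (i, j).
  by rewrite pair_big_dep /=; apply: eq_big => [] [i j].
rewrite (bigD1 ord0) //=.
(* The second, third and fifth of the eight cases are inconsistent, so their sums are empty. *)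
case: t => [[[] []] []].
- rewrite [X in _ + X]big1 ?addr0.
    by rewrite (big_pred1 ord0) // => j; rewrite /ptype /= (eq_sym ord0);
      case: (j == ord0).
  move=> i i0; rewrite big1 // => j; rewrite /ptype /= (negPf i0) //.
- rewrite [X in _ + X]big1 ?addr0.
    by rewrite big1 // => j; rewrite /ptype /= (eq_sym ord0); case: (j == ord0).
  by move=> i i0; rewrite big1 // => j; rewrite /ptype /= (negPf i0).
- rewrite [X in _ + X]big1 ?addr0.
    by rewrite big1 // => j; rewrite /ptype /= (eq_sym ord0); case: (j == ord0).
  by move=> i i0; rewrite big1 // => j; rewrite /ptype /= (negPf i0).
- rewrite [X in _ + X]big1 ?addr0.
    rewrite -[RHS]d0j'; apply: eq_bigl => j.
    by rewrite /ptype /= (eq_sym ord0); case: (j == ord0).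
  by move=> i i0; rewrite big1 // => j; rewrite /ptype /= (negPf i0).
- rewrite [X in X + _]big1 ?add0r; last by move=> j.
  rewrite big1 // => i i0; rewrite big1 // => j; rewrite /ptype /= (negPf i0).
  by case: (eqVneq j ord0) => [->|_]; rewrite ?(negPf i0).
- rewrite [X in X + _]big1 ?add0r; last by move=> j.
  rewrite -[RHS]di0'; apply: eq_bigr => i i0; rewrite (big_pred1 ord0) // => j.
  rewrite /ptype /= (negPf i0).
  by case: (eqVneq j ord0) => [->|_]; rewrite ?(negPf i0).
- rewrite [X in X + _]big1 ?add0r; last by move=> j.
  rewrite -[RHS]dii'; apply: eq_bigr => i i0; rewrite (big_pred1 i) // => j.
  rewrite /ptype /= (negPf i0) (eq_sym j i).
  by case: (eqVneq j ord0) => [->|_]; rewrite ?(negPf i0) //; case: (i == j).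
- rewrite [X in X + _]big1 ?add0r; last by move=> j.
  rewrite -[RHS]dne; apply: eq_bigr => i i0; apply: eq_bigl => j.
  by rewrite /ptype /= (negPf i0); case: (j == ord0); case: (i == j).
Qed.

(** * Second moments at one attribute *)

Lemma kap_0l j : kap ord0 j = 0. Proof. by rewrite /kap eqxx. Qed.
Lemma kap_0r i : kap i ord0 = 0. Proof. by rewrite kapC kap_0l. Qed.

Lemma kap_eq i : i != ord0 -> kap i i = 1 - v%:R^-1.
Proof. by rewrite /kap eqxx orbb => /negPf ->. Qed.

Lemma kap_neq i j : i != ord0 -> j != ord0 -> i != j -> kap i j = - v%:R^-1.
Proof. by rewrite /kap => /negPf -> /negPf -> /negPf ->; rewrite sub0r. Qed.

Lemma moment_0 a b : f1x ord0 a * f1x ord0 b = gram a b * kapx a ord0 ord0.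
Proof.
case: a b => [a|] [b|] /=; rewrite ?f1_0 // ?kap_0l; by rewrite !(mul0r, mulr0, mul1r).
Qed.

Lemma moment_diag a b :
  \sum_i f1x i a * f1x i b = \sum_i gram a b * kapx a i i.
Proof.
case: a b => [a|] [b|] /=.
- rewrite sum_f1_f1 // -mulr_sumr -mulr_suml sum_kap_diag // divff ?mulr1 //.
  exact: v1_neq0.
- under eq_bigr => i _ do rewrite mulr1.
  by rewrite sum_f1 // big1 // => i _; rewrite mul0r.
- under eq_bigr => i _ do rewrite mul1r.
  by rewrite sum_f1 // big1 // => i _; rewrite mul0r.
- by [].
Qed.

(** Lets a second moment be exchanged, under an average over patterns, for a Gram entry times a
    kernel value that does not involve [b]. *)
Lemma same_sums_fst a b :
  same_sums (fun p => f1x p.1 a * f1x p.1 b)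
                (fun p => gram a b * kapx a p.1 p.1).
Proof.
split=> /=; try exact: moment_diag; try exact: moment_0.
  by apply: eq_bigr => j _; exact: moment_0.
by rewrite exchange_big [RHS]exchange_big /=; apply: eq_bigr => j _; exact: moment_diag.
Qed.

Lemma same_sums_snd a b :
  same_sums (fun p => f1x p.2 a * f1x p.2 b)
                (fun p => gram a b * kapx a p.2 p.2).
Proof.
split=> /=; try exact: moment_diag; try exact: moment_0.
  by apply: eq_bigr => j _; exact: moment_0.
by apply: eq_bigr => j _; exact: moment_diag.
Qed.

(** Unless both codes are [None], every sum except the diagonal one vanishes on both sides, since
    [f1] and [kap] sum to zero over the levels and vanish at level 0. *)
Lemma same_sums_mix a b :
  same_sums (fun p => f1x p.1 a * f1x p.2 b)
                (fun p => gram a b * kapx a p.1 p.2).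
Proof.
split=> /=; try exact: moment_diag; try exact: moment_0; case: a b => [a|] [b|] //=.
- rewrite !big1 // => j _; first by rewrite kap_0l mul0r mulr0.
  by rewrite f1_0 ?mul0r.
- by rewrite !big1 // => j _; rewrite ?f1_0 ?mul0r.
- rewrite -mulr_sumr sum_f1 // mulr0 big1 // => j _; by rewrite mul0r.
- rewrite !big1 // => j _; first by rewrite kap_0r mul0r mulr0.
  by rewrite f1_0 ?mulr0.
- rewrite -mulr_suml sum_f1 // mul0r big1 // => j _; by rewrite mul0r.
- by rewrite !big1 // => j _; rewrite ?f1_0 ?mul0r ?mulr0.
- rewrite !big1 // => i _; first by rewrite -mulr_sumr -mulr_suml sum_kap_r // mul0r mulr0.
  by rewrite -mulr_sumr sum_f1 // mulr0.
- rewrite [RHS]big1 => [|i _]; last by rewrite big1 // => j _; rewrite mul0r.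
  rewrite exchange_big big1 // => i _; by rewrite -mulr_suml sum_f1 // mul0r.
- rewrite [RHS]big1 => [|i _]; last by rewrite big1 // => j _; rewrite mul0r.
  by rewrite big1 // => i _; rewrite -mulr_sumr sum_f1 // mulr0.
Qed.

End Levels.

(** * Averaging over attributewise patterns *)

Section Average.
Variables (R : realFieldType) (K v : nat).
Local Notation lev := 'I_v.+1.

Definition type_invariant (xi : pt K v -> R) := forall x y : pt K v,
  (forall k, ptype v (x.1 k, x.2 k) = ptype v (y.1 k, y.2 k)) -> xi x = xi y.

(** Once the pattern at every attribute is fixed, [xi] is constant and the sum of products becomes a
    product over attributes of sums over one pattern; each factor is determined by the sums in
    [same_sums]. *)
Lemma sum_prod_same_sums (xi : pt K v -> R) (F F' : 'I_K -> lev * lev -> R) :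
  type_invariant xi -> (forall k, same_sums R v (F k) (F' k)) ->
  \sum_x xi x * \prod_k F k (x.1 k, x.2 k) =
  \sum_x xi x * \prod_k F' k (x.1 k, x.2 k).
Proof.
move=> xiT FF'.
(* A pair of profiles is read as one function into pairs of levels, the form in which sums of
   products distribute. *)
pose z (y : {ffun 'I_K -> lev * lev}) : pt K v :=
  ([ffun k => (y k).1], [ffun k => (y k).2]).
pose z' (x : pt K v) : {ffun 'I_K -> lev * lev} := [ffun k => (x.1 k, x.2 k)].
have zK : cancel z z'.
  by move=> y; apply/ffunP => k; rewrite !ffunE /=; case: (y k).
have z'K : cancel z' z.
  by case=> x1 x2; congr (_, _); apply/ffunP => k; rewrite !ffunE.
pose ty (y : {ffun 'I_K -> lev * lev}) := [ffun k => ptype v (y k)].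
have key (G : 'I_K -> lev * lev -> R) :
    \sum_x xi x * \prod_k G k (x.1 k, x.2 k) =
    \sum_t \sum_(y | ty y == t) xi (z y) * \prod_k G k (y k).
  rewrite (reindex z) /=; last by exists z' => ? _.
  rewrite (partition_big ty predT) //=.
  apply: eq_bigr => t _; apply: eq_bigr => y _; congr (_ * _).
  by apply: eq_bigr => k _; rewrite !ffunE; case: (y k).
rewrite !key; apply: eq_bigr => t _.
(* A realised pattern supplies [y0], at which the constant value of [xi] is read off; other patterns
   give empty sums. *)
case: (pickP (fun y => ty y == t)) => [y0 /eqP ty0|e]; last by rewrite !big_pred0.
have step (G : 'I_K -> lev * lev -> R) :
    \sum_(y | ty y == t) xi (z y) * \prod_k G k (y k) =
    xi (z y0) * \prod_k \sum_(p | ptype v p == t k) G k p.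
  rewrite bigA_distr_big_dep mulr_sumr.
  apply: eq_big => [y|y /eqP tyE].
    apply/eqP/familyP => [<- k|h]; first by rewrite unfold_in ffunE.
    by apply/ffunP => k; rewrite ffunE; apply/eqP; have := h k; rewrite unfold_in.
  congr (_ * _); apply: xiT => k; rewrite !ffunE.
  move: (congr1 (fun u : {ffun _} => u k) ty0); rewrite -tyE !ffunE.
  by case: (y k) (y0 k) => [? ?] [].
rewrite !step; congr (_ * _); apply: eq_bigr => k _.
exact: same_sums_ptype.
Qed.

End Average.

(** * Encoding of the model coordinates *)

Section Encoding.
Variables (R : realFieldType) (K v : nat).
Local Notation lev := 'I_v.+1.
Local Notation par := 'I_v.-1.
Local Notation code := {ffun 'I_K -> option par}.

Definition supp (e : code) : {set 'I_K} := [set k | e k != None].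

Definition encode (r : idx K v) : code :=
  match r with
  | inl (k, a) => [ffun m => if m == k then Some a else None]
  | inr (inl y) => let: ((k, l), (a, b)) := val y in
      [ffun m => if m == k then Some a else if m == l then Some b else None]
  | inr (inr z) => let: ((k, l, m), (a, b, c)) := val z in
      [ffun n => if n == k then Some a else if n == l then Some b
                 else if n == m then Some c else None]
  end.

Definition monom (i : prof K v) (e : code) : R := \prod_k f1x R v (i k) (e k).

Lemma feat_encode i r : feat R i r = monom i (encode r).
Proof.
rewrite /monom; case: r => [[k a]|[[[[k l] [a b]] /= kl]|[[[[k l] m] [[a b] c]] /= klm]]].
- rewrite /= (bigD1 k) //= ffunE eqxx big1 ?mulr1 // => m /negPf mk.
  by rewrite ffunE mk.
- have lk : l != k by rewrite -(inj_eq val_inj) gtn_eqF.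
  rewrite (bigD1 k) //= (bigD1 l) //= !ffunE eqxx (negPf lk) eqxx big1 ?mulr1 //.
  by move=> m /andP[/negPf mk /negPf ml]; rewrite ffunE mk ml.
- case/andP: klm => kl lm.
  have lk : l != k by rewrite -(inj_eq val_inj) gtn_eqF.
  have ml : m != l by rewrite -(inj_eq val_inj) gtn_eqF.
  have mk : m != k by rewrite -(inj_eq val_inj) gtn_eqF // (ltn_trans kl).
  rewrite (bigD1 k) //= (bigD1 l) //= (bigD1 m) /= ?mk //.
  rewrite !ffunE !eqxx (negPf lk) (negPf mk) (negPf ml) big1 ?mulr1 ?mulrA //.
  by move=> n /andP[/andP[/negPf nk /negPf nl] /negPf nm]; rewrite ffunE nk nl nm.
Qed.

(** A common list form for the three kinds of index, used to compare indices through their codes. *)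
Definition idx_seq (r : idx K v) : seq ('I_K * par) :=
  match r with
  | inl y => [:: y]
  | inr (inl y) => let: ((k, l), (a, b)) := val y in [:: (k, a); (l, b)]
  | inr (inr z) => let: ((k, l, m), (a, b, c)) := val z in
      [:: (k, a); (l, b); (m, c)]
  end.

Lemma idx_seq_inj : injective idx_seq.
Proof.
move=> [[k a]|[[[[k l] [a b]] /= p]|[[[[k l] m] [[a b] c]] /= p]]];
move=> [[k' a']|[[[[k' l'] [a' b']] /= p']|[[[[k' l'] m'] [[a' b'] c']] /= p']]] //= [].
- by move=> -> ->.
- by move=> *; subst; congr (inr (inl _)); apply: val_inj.
- by move=> *; subst; congr (inr (inr _)); apply: val_inj.
Qed.

Lemma idx_seq_sorted r :
  sorted (fun x y : 'I_K * par => x.1 < y.1)%N (idx_seq r).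
Proof.
by case: r => [[k a]|[[[[k l] [a b]] /= ->]|[[[[k l] m] [[a b] c]] /= /andP[-> ->]]]].
Qed.

Lemma mem_idx_seq r x : (x \in idx_seq r) = (encode r x.1 == Some x.2).
Proof.
case: x => n d; case: r => [[k a]|[[[[k l] [a b]] /= kl]|[[[[k l] m] [[a b] c]] /= klm]]].
- rewrite /= ffunE inE xpair_eqE; case: (n == k) => //=.
  by rewrite eq_sym.
- rewrite ffunE !inE !xpair_eqE; case: (eqVneq n k) => [->|nk] /=.
    by rewrite (ltn_eqF kl : (k == l) = _) orbF eq_sym.
  by case: (n == l) => //=; rewrite eq_sym.
- case/andP: klm => kl lm.
  have kl' : (k == l) = false := ltn_eqF kl.
  have lm' : (l == m) = false := ltn_eqF lm.
  have km' : (k == m) = false := ltn_eqF (ltn_trans kl lm).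
  rewrite ffunE !inE !xpair_eqE; case: (eqVneq n k) => [->|nk] /=.
    by rewrite kl' km' !orbF eq_sym.
  case: (eqVneq n l) => [->|nl] /=; first by rewrite lm' orbF eq_sym.
  by case: (n == m) => //=; rewrite eq_sym.
Qed.

(** The code determines the members of the list [idx_seq], and a list strictly sorted by attribute
    is determined by its members. *)
Lemma encode_inj : injective encode.
Proof.
move=> r s rs; apply: idx_seq_inj.
apply: (irr_sorted_eq _ _ (idx_seq_sorted r) (idx_seq_sorted s)) => [x y z|x|x].
- exact: ltn_trans.
- exact: ltnn.
- by rewrite !mem_idx_seq rs.
Qed.

Lemma card_supp_encode r : (0 < #|supp (encode r)| <= 3)%N.
Proof.
have -> : supp (encode r) = [set x.1 | x in idx_seq r].
  apply/setP => k; rewrite inE; apply/idP/imsetP => [|[[k' a]]].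
    case E : (encode r k) => [a|//] _; exists (k, a) => //.
    by rewrite mem_idx_seq E.
  by rewrite mem_idx_seq /= => /eqP + -> => ->.
have le3 : (#|[set x.1 | x in idx_seq r]| <= size (idx_seq r))%N.
  exact: leq_trans (leq_imset_card _ _) (card_size _).
have [x xr] : exists x, x \in idx_seq r.
  case: r {le3} => [[k a]|[[[[k l] [a b]] /= kl]|[[[[k l] m] [[a b] c]] /= klm]]];
  by exists (k, a); rewrite inE eqxx.
apply/andP; split; last first.
  apply: (leq_trans le3).
  by case: r {le3 xr} => [[k a]|[[[[k l] [a b]] /= kl]|[[[[k l] m] [[a b] c]] /= klm]]].
by rewrite card_gt0; apply/set0Pn; exists x.1; apply: imset_f.
Qed.

Lemma enum_ord_sorted (A : {set 'I_K}) : sorted (fun k l : 'I_K => k < l)%N (enum A).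
Proof.
rewrite /enum_mem; apply: sorted_filter => [x y z|]; first exact: ltn_trans.
by have := iota_ltn_sorted 0 K; rewrite -val_enum_ord sorted_map enumT.
Qed.

(** Enumerating the support in increasing order yields the attributes already ordered as the index
    types demand. *)
Lemma encode_surj (e : code) : (0 < #|supp e| <= 3)%N -> exists r, encode r = e.
Proof.
have memE k : (k \in enum (supp e)) = (e k != None) by rewrite mem_enum inE.
have someE k : k \in enum (supp e) -> exists a, e k = Some a.
  by rewrite memE; case: (e k) => // a _; exists a.
have := enum_ord_sorted (supp e).
rewrite cardE.
case: (enum (supp e)) memE someE => [|k [|l [|m []]]] //= memE someE.
- move=> _ _; have [a ea] := someE k (mem_head _ _).
  exists (inl (k, a)); apply/ffunP => n; rewrite ffunE.
  case: eqVneq => [->//|nk]; have := memE n; rewrite !inE (negPf nk).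
  by case: (e n).
- rewrite andbT => kl _.
  have [a ea] : exists a, e k = Some a by apply: someE; rewrite !inE eqxx.
  have [b eb] : exists a, e l = Some a by apply: someE; rewrite !inE eqxx orbT.
  exists (inr (inl (Sub ((k, l), (a, b)) kl))); apply/ffunP => n.
  rewrite ffunE.
  case: (eqVneq n k) => [->//|nk]; case: (eqVneq n l) => [->//|nl].
  by have := memE n; rewrite !inE (negPf nk) (negPf nl); case: (e n).
- rewrite andbT => klm _.
  have [a ea] : exists a, e k = Some a by apply: someE; rewrite !inE eqxx.
  have [b eb] : exists a, e l = Some a by apply: someE; rewrite !inE eqxx orbT.
  have [c ec] : exists a, e m = Some a by apply: someE; rewrite !inE eqxx !orbT.
  exists (inr (inr (Sub ((k, l, m), (a, b, c)) klm))); apply/ffunP => n.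
  rewrite ffunE.
  case: (eqVneq n k) => [->//|nk]; case: (eqVneq n l) => [->//|nl].
  case: (eqVneq n m) => [->//|nm].
  by have := memE n; rewrite !inE (negPf nk) (negPf nl) (negPf nm); case: (e n).
Qed.

(** Turns matrix sums into sums over codes, which factorise over attributes once the bound on the
    support is lifted. *)
Lemma sum_encode (F : code -> R) :
  \sum_(r < #|{: idx K v}|) F (encode (enum_val r)) =
  \sum_(e | (0 < #|supp e| <= 3)%N) F e.
Proof.
rewrite -(big_enum_val (fun r => F (encode r))) /=.
transitivity (\sum_(e in [set encode r | r in {: idx K v}]) F e).
  by rewrite big_imset //= => r s _ _; exact: encode_inj.
apply: eq_bigl => e; apply/imsetP/idP => [[r _ ->]|/encode_surj[r <-]].
  exact: card_supp_encode.
by exists r.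
Qed.

End Encoding.

(** * The information matrix and its inverse *)

Section Information.
Variables (R : realFieldType) (K v : nat).
Hypothesis hv : (2 <= v)%N.
Local Notation par := 'I_v.-1.
Local Notation code := {ffun 'I_K -> option par}.
Local Notation supp := (supp K v).
Local Notation monom := (monom R K v).
Local Notation kap := (kap R v).

Definition kprod (B : {set 'I_K}) (i j : prof K v) : R := \prod_(k in B) kap (i k) (j k).

(** This is q_B: the part of the difference vector with support B, evaluated in the inverse of the
    tensor power of I + J. *)
Definition qform (B : {set 'I_K}) (x : pt K v) : R :=
  kprod B x.1 x.1 + kprod B x.2 x.2 - 2 * kprod B x.1 x.2.

(** This is g_B, the scalar in front of the tensor power of I + J; the powers of v - 1 come from
    [kapx]. *)
Definition block_coef (xi : pt K v -> R) (B : {set 'I_K}) : R :=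
  (\sum_x xi x * qform B x) / (v%:R - 1) ^+ #|B|.

Definition gram_inv_prod (e e' : code) : R := \prod_k gram_inv R v (e k) (e' k).

Lemma prod_kapx (e : code) (i j : prof K v) :
  \prod_k kapx R v (e k) (i k) (j k) = kprod (supp e) i j / (v%:R - 1) ^+ #|supp e|.
Proof.
rewrite /kprod -prodr_const -prodf_div [RHS]big_mkcond /=.
by apply: eq_bigr => k _; rewrite inE; case: (e k).
Qed.

Lemma supp_neqP (e e' : code) : supp e != supp e' ->
  exists k, (e k == None) != (e' k == None).
Proof.
move=> ee'; apply/existsP; apply: contraNT ee'; rewrite negb_exists => /forallP h.
by apply/eqP/setP => k; rewrite !inE; have := h k; rewrite negbK => /eqP ->.
Qed.

Lemma prod_gram_eq0 (e e' : code) : supp e != supp e' ->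
  \prod_k gram R v (e k) (e' k) = 0.
Proof.
move=> /supp_neqP[k ek]; rewrite (bigD1 k) //=.
by case: (e k) (e' k) ek => [a|] [b|] // _; rewrite mul0r.
Qed.

Lemma gram_inv_prod_eq0 (e e' : code) : supp e != supp e' ->
  gram_inv_prod e e' = 0.
Proof.
move=> /supp_neqP[k ek]; rewrite /gram_inv_prod (bigD1 k) //=.
by case: (e k) (e' k) ek => [a|] [b|] // _; rewrite mul0r.
Qed.

Lemma gramC (a b : option par) : gram R v a b = gram R v b a.
Proof. by case: a b => [a|] [b|] //=; rewrite eq_sym. Qed.

(** The product of differences expands into four products over attributes. In each, the
    one-attribute moments are exchanged for Gram entries times kernel values, and the kernel parts
    recombine into [qform]. *)
Lemma moment_monom (xi : pt K v -> R) (e e' : code) : type_invariant R K v xi ->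
  \sum_x xi x * ((monom x.1 e - monom x.2 e) * (monom x.1 e' - monom x.2 e')) =
  \prod_k gram R v (e k) (e' k) * block_coef xi (supp e).
Proof.
move=> xiT.
pose T := option par; pose L := ('I_v.+1 * 'I_v.+1)%type.
have gather (G : T -> T -> L -> R) (G' : T -> L -> R) (c c' : code) :
    (forall a b, same_sums R v (G a b) (fun p => gram R v a b * G' a p)) ->
    \sum_x xi x * \prod_k G (c k) (c' k) (x.1 k, x.2 k) =
    \prod_k gram R v (c k) (c' k) * \sum_x xi x * \prod_k G' (c k) (x.1 k, x.2 k).
  move=> GG'.
  rewrite (sum_prod_same_sums _ _ _ _ (fun k => G (c k) (c' k))
    (fun k p => gram R v (c k) (c' k) * G' (c k) p)) //.
  rewrite mulr_sumr; apply: eq_bigr => x _.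
  by rewrite big_split /= mulrCA.
have fst2 := gather _ _ e e' (same_sums_fst R v hv).
have snd2 := gather _ _ e e' (same_sums_snd R v hv).
have mix := gather _ _ e e' (same_sums_mix R v hv).
have mix' := gather _ _ e' e (same_sums_mix R v hv).
transitivity (\sum_x xi x * (\prod_k (f1x R v (x.1 k) (e k) * f1x R v (x.1 k) (e' k)))
 + \sum_x xi x * (\prod_k (f1x R v (x.2 k) (e k) * f1x R v (x.2 k) (e' k)))
 - \sum_x xi x * (\prod_k (f1x R v (x.1 k) (e k) * f1x R v (x.2 k) (e' k)))
 - \sum_x xi x * (\prod_k (f1x R v (x.1 k) (e' k) * f1x R v (x.2 k) (e k)))).
  rewrite -big_split -!sumrB /=; apply: eq_bigr => x _.
  by rewrite !big_split /monom /=; ring.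
rewrite {}fst2 {}snd2 {}mix {}mix' /=.
(* The last term carries the support of [e'], so the four kernels combine only for equal supports;
   otherwise every Gram product is zero. *)
have [ee'|/prod_gram_eq0 g0] := eqVneq (supp e) (supp e'); last first.
  have -> : \prod_k gram R v (e' k) (e k) = 0.
    by rewrite -g0; apply: eq_bigr => k _; exact: gramC.
  by rewrite g0 !mul0r !subr0 addr0.
rewrite (eq_bigr (fun k => gram R v (e k) (e' k)) (fun k _ => gramC (e' k) (e k))).
rewrite -mulrDr -!mulrBr; congr (_ * _).
rewrite /block_coef mulr_suml -big_split -!sumrB /=; apply: eq_bigr => x _.
by rewrite !prod_kapx -ee' /qform; ring.
Qed.

Lemma prod_natr_eq (I : finType) (T : eqType) (e e' : {ffun I -> T}) :
  \prod_k (e k == e' k)%:R = (e == e')%:R :> R.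
Proof.
have [->|ne] := eqVneq e e'; first by rewrite big1 // => k _; rewrite eqxx.
have /existsP[k /negPf ek] : [exists k, e k != e' k].
  apply: contraNT ne; rewrite negb_exists => /forallP h.
  by apply/eqP/ffunP => k; apply/eqP; have := h k; rewrite negbK.
by rewrite (bigD1 k) //= ek mul0r.
Qed.

(** Letting [c] run over all codes, with supports of any size, makes the sum factorise into
    one-attribute inverse relations. *)
Lemma sum_gram_inv_prod (e e' : code) :
  \sum_(c : code) \prod_k gram R v (e k) (c k) * gram_inv_prod c e' = (e == e')%:R.
Proof.
under eq_bigr => c _ do rewrite /gram_inv_prod -big_split /=.
rewrite -(bigA_distr_bigA (fun k a => gram R v (e k) a * gram_inv R v a (e' k))) /=.
rewrite -prod_natr_eq; apply: eq_bigr => k _; exact: gram_invK.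
Qed.

(** Fixing the support is a separate condition at each attribute, so the sum still factorises:
    attributes in B contribute [kap], the others contribute 1. *)
Lemma sum_monom_gram_inv (i j : prof K v) (B : {set 'I_K}) :
  \sum_(e | supp e == B) monom i e * \sum_e' gram_inv_prod e e' * monom j e' =
  kprod B i j.
Proof.
pose h k a := \sum_b gram_inv R v a b * f1x R v (j k) b.
have inner (e : code) : \sum_e' gram_inv_prod e e' * monom j e' = \prod_k h k (e k).
  rewrite /h (bigA_distr_bigA (fun k b => gram_inv R v (e k) b * f1x R v (j k) b)).
  by apply: eq_bigr => e' _; rewrite /= big_split.
under eq_bigr => e _ do rewrite inner /monom -big_split /=.
pose Q k (a : option par) := (a != None) == (k \in B).
rewrite (eq_bigl (fun e : code => e \in family Q)); last first.
  move=> e; apply/eqP/familyP => [eB k|hQ].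
    by rewrite unfold_in /Q -eB inE eqxx.
  by apply/setP => k; rewrite inE; have := hQ k; rewrite unfold_in => /eqP.
rewrite -(bigA_distr_big_dep (fun k a => Q k a)
  (fun k a => f1x R v (i k) a * h k a)) /=.
rewrite /kprod [RHS]big_mkcond /=; apply: eq_bigr => k _.
rewrite big_mkcond sum_option /Q /=; case: (k \in B) => /=.
  rewrite add0r -sum_f1_gram_inv //; apply: eq_bigr => a _; congr (_ * _).
  by rewrite /h sum_option /= mul0r add0r.
rewrite [X in _ + X]big1 // addr0 mul1r /h sum_option /= mul1r.
by rewrite big1 ?addr0 // => b _; rewrite mul0r.
Qed.

Section Inverse.
Variable xi : pt K v -> R.
Hypothesis xiT : type_invariant R K v xi.
Hypothesis block_coef_neq0 : forall B : {set 'I_K}, (0 < #|B| <= 3)%N -> block_coef xi B != 0.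

Local Notation ev r := (encode K v (enum_val r)).

Definition infomx_inv : 'M[R]_#|{: idx K v}| :=
  \matrix_(r, s) (gram_inv_prod (ev r) (ev s) / block_coef xi (supp (ev r))).

Lemma dvecE (x : pt K v) r : dvec R x r 0 = monom x.1 (ev r) - monom x.2 (ev r).
Proof. by rewrite !mxE !feat_encode. Qed.

Lemma infomxE r s : infomx xi r s =
  \prod_k gram R v (ev r k) (ev s k) * block_coef xi (supp (ev r)).
Proof.
rewrite -moment_monom // /infomx summxE; apply: eq_bigr => x _.
by rewrite !mxE big_ord1 !mxE -!dvecE !mxE.
Qed.

Lemma infomx_mul_inv : infomx xi *m infomx_inv = 1%:M.
Proof.
apply/matrixP => r s; rewrite !mxE.
under eq_bigr => t _ do rewrite infomxE [infomx_inv _ _]mxE.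
rewrite (sum_encode R K v (fun c => \prod_k gram R v (ev r k) (c k) *
  block_coef xi (supp (ev r)) * (gram_inv_prod c (ev s) / block_coef xi (supp c)))).
have r3 := card_supp_encode K v (enum_val r).
transitivity (\sum_(c : code) \prod_k gram R v (ev r k) (c k) * gram_inv_prod c (ev s)).
  rewrite big_mkcond /=; apply: eq_bigr => c _.
  have [<-|/prod_gram_eq0 ->] := eqVneq (supp (ev r)) (supp c).
    by rewrite r3; field; exact: block_coef_neq0.
  by rewrite !mul0r if_same.
rewrite sum_gram_inv_prod; congr (_%:R).
by rewrite (inj_eq (encode_inj K v)) (inj_eq enum_val_inj).
Qed.

Lemma infomx_unit : infomx xi \in unitmx.
Proof. by have [] := mulmx1_unit infomx_mul_inv. Qed.

Lemma invmx_infomx : invmx (infomx xi) = infomx_inv.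
Proof. by rewrite -[LHS]mulmx1 -infomx_mul_inv mulKmx // infomx_unit. Qed.

(** The inverse is block diagonal over supports, so the coordinates are grouped by their support B
    and each group is a quadratic form divided by its scalar. *)
Lemma varfE (x : pt K v) :
  varf xi x = \sum_(B : {set 'I_K} | (0 < #|B| <= 3)%N) qform B x / block_coef xi B.
Proof.
pose D e := monom x.1 e - monom x.2 e.
pose H e e' := gram_inv_prod e e'.
have -> : varf xi x = \sum_(e | (0 < #|supp e| <= 3)%N)
    D e * (\sum_e' H e e' * D e') / block_coef xi (supp e).
  rewrite -(sum_encode R K v
    (fun e => D e * (\sum_e' H e e' * D e') / block_coef xi (supp e))).
  rewrite /varf -mulmxA mxE; apply: eq_bigr => r _.
  rewrite mxE dvecE -mulrA; congr (_ * _).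
  rewrite invmx_infomx mxE mulr_suml.
  under eq_bigr => s _ do rewrite dvecE mxE.
  rewrite (sum_encode R K v (fun e' => gram_inv_prod (ev r) e' / block_coef xi (supp (ev r)) *
     (monom x.1 e' - monom x.2 e'))) big_mkcond /=.
  (* The added codes have supports of other sizes than that of row [r], so [gram_inv_prod] vanishes
     on them. *)
  apply: eq_bigr => e' _.
  case: ifP => [_|e'3]; first by rewrite mulrAC.
  rewrite /H gram_inv_prod_eq0 ?mul0r //.
  by apply: contraFneq e'3 => <-; exact: card_supp_encode.
rewrite (partition_big supp (fun B : {set 'I_K} => 0 < #|B| <= 3)%N) //=.
apply: eq_bigr => B B3.
transitivity ((\sum_(e | supp e == B) D e * (\sum_e' H e e' * D e')) / block_coef xi B).
  rewrite mulr_suml; apply: eq_big => [e|e /andP[_ /eqP ->] //].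
  by case: eqP => [->|]; rewrite ?B3 ?andbF.
congr (_ / _).
(* The form is split bilinearly so that each piece is one value of [kprod]. *)
pose W i j := \sum_(e | supp e == B) monom i e * \sum_e' H e e' * monom j e'.
transitivity (W x.1 x.1 - W x.1 x.2 - (W x.2 x.1 - W x.2 x.2)).
  rewrite /W -!sumrB; apply: eq_bigr => e _.
  have -> : \sum_e' H e e' * D e' =
     \sum_e' H e e' * monom x.1 e' - \sum_e' H e e' * monom x.2 e'.
    by rewrite -sumrB; apply: eq_bigr => e' _; rewrite mulrBr.
  by rewrite /D; ring.
rewrite /W !sum_monom_gram_inv /qform.
have -> : kprod B x.2 x.1 = kprod B x.1 x.2 by apply: eq_bigr => k _; exact: kapC.
by ring.
Qed.

End Inverse.

End Information.

(** * Differences and binomial coefficients in a field *)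

Lemma natrB_neq0 (R : numDomainType) m n : (m < n)%N -> n%:R - m%:R != 0 :> R.
Proof. by move=> mn; rewrite subr_eq0 eqr_nat gtn_eqF. Qed.

Lemma natr_bin2 (R : numFieldType) n : 'C(n, 2)%:R = n%:R * (n%:R - 1) / 2 :> R.
Proof.
have <- : 'C(n, 2)%:R * 2 = n%:R * (n%:R - 1) :> R; last by field.
rewrite (_ : 2 = (2`!)%:R) // -natrM bin_ffact !ffactnS ffactn0 muln1 natrM.
by case: n => [|n]; rewrite ?mul0r // -natr1 addrK.
Qed.

Lemma natr_bin3 (R : numFieldType) n :
  'C(n, 3)%:R = n%:R * (n%:R - 1) * (n%:R - 2) / 6 :> R.
Proof.
have <- : 'C(n, 3)%:R * 6 = n%:R * (n%:R - 1) * (n%:R - 2) :> R; last by field.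
rewrite (_ : 6 = (3`!)%:R) // -natrM bin_ffact !ffactnS ffactn0 muln1 natrM.
case: n => [|[|n]]; rewrite ?mul0r //=; first by rewrite subrr mulr0 !mul0r.
have -> : n.+2%:R - 2 = n%:R :> R by rewrite -(addn2 n) natrD addrK.
have -> : n.+2%:R - 1 = n.+1%:R :> R by rewrite -natr1 addrK.
by rewrite natrM mulrA.
Qed.

(** * Elementary symmetric functions *)

Section Symmetric.
Variables (R : realFieldType) (I : finType) (c : I -> R).

Definition elem (q : nat) : R := \sum_(B : {set I} | #|B| == q) \prod_(k in B) c k.
Definition psum (n : nat) : R := \sum_k c k ^+ n.

(** The generating polynomial replaces a sum over subsets by a product, which can be handled one
    factor at a time. *)
Lemma elem_coef q : elem q = (\prod_k (1 + (c k)%:P * 'X))`_q.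
Proof.
under eq_bigr => k _ do rewrite addrC.
rewrite bigA_distr coef_sum /elem big_mkcond /=; apply: eq_bigr => B _.
rewrite -big_mkcond /= big_split /= prodr_const.
rewrite -rmorph_prod mul_polyC coefZ coefXn eq_sym.
by case: (q == _); rewrite ?mulr1 ?mulr0.
Qed.

Lemma newton_identities :
  [/\ elem 1 = psum 1, 2 * elem 2 = psum 1 ^+ 2 - psum 2 &
      6 * elem 3 = psum 1 ^+ 3 - 3 * psum 1 * psum 2 + 2 * psum 3].
Proof.
rewrite !elem_coef /psum.
(* The constant coefficient joins the induction because a new factor adds [c k] times the preceding
   coefficient. *)
suff [_ //] : (\prod_k (1 + (c k)%:P * 'X))`_0 = 1 /\ [/\
    (\prod_k (1 + (c k)%:P * 'X))`_1 = \sum_k c k ^+ 1,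
    2 * (\prod_k (1 + (c k)%:P * 'X))`_2 = (\sum_k c k ^+ 1) ^+ 2 - \sum_k c k ^+ 2 &
    6 * (\prod_k (1 + (c k)%:P * 'X))`_3 = (\sum_k c k ^+ 1) ^+ 3 -
       3 * (\sum_k c k ^+ 1) * (\sum_k c k ^+ 2) + 2 * \sum_k c k ^+ 3].
elim: (index_enum I) => [|k s [IH0 [IH1 IH2 IH3]]].
  by rewrite !big_nil !coef1 /=; split=> //; split; ring.
rewrite !big_cons; set P := \prod_(_ <- s) _ in IH0 IH1 IH2 IH3 *.
have cE n : ((1 + (c k)%:P * 'X) * P)`_n.+1 = P`_n.+1 + c k * P`_n.
  by rewrite mulrDl mul1r coefD -mulrA coefCM coefXM.
have c0 : ((1 + (c k)%:P * 'X) * P)`_0 = P`_0.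
  by rewrite mulrDl mul1r coefD -mulrA coefCM coefXM mulr0 addr0.
rewrite !cE c0 IH0 IH1; split=> //; split.
- by ring.
- rewrite mulrDr IH2; ring.
- have e2 : P`_2 = ((\sum_(j <- s) c j ^+ 1) ^+ 2 - \sum_(j <- s) c j ^+ 2) / 2.
    by rewrite -IH2; field.
  by rewrite mulrDr IH3 e2; field.
Qed.

End Symmetric.

(** Induction on the size of A \ B: transposing an element of A \ B with one of B \ A keeps the
    value and the cardinality and brings A closer to B. *)
Lemma tperm_invariant_card (T : finType) (U : Type) (f : {set T} -> U) :
  (forall a b (B : {set T}), f (tperm a b @: B) = f B) ->
  forall A B : {set T}, #|A| = #|B| -> f A = f B.
Proof.
move=> fI A B; have [n] := ubnP #|A :\: B|; elim: n A => // n IH A.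
rewrite ltnS => ABn cAB.
have [/eqP|[a aAB]] := set_0Vmem (A :\: B).
  by rewrite setD_eq0 => AB; congr f; apply/eqP; rewrite eqEcard AB cAB leqnn.
have [/eqP|[b bBA]] := set_0Vmem (B :\: A).
  rewrite setD_eq0 => BA.
  have /eqP AB : B == A by rewrite eqEcard BA cAB leqnn.
  by rewrite AB setDv inE in aAB.
move: (aAB) (bBA); rewrite !inE => /andP[aB aA] /andP[bA bB].
rewrite -(fI a b A); apply: IH; last by rewrite card_imset //; exact: perm_inj.
(* The only element gained by the swap is [b], which lies in B, while [a] leaves the difference. *)
apply: leq_trans ABn; apply: proper_card; apply/properP; split.
  apply/subsetP => x; rewrite !inE => /andP[xB /imsetP[y yA xE]].
  rewrite xB /=; move: xE xB; case: tpermP => [yE ->|yE _|_ _ ->].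
  - by rewrite bB.
  - by rewrite yE (negPf bA) in yA.
  - by rewrite yA.
exists a => //; rewrite inE negb_and; apply/orP; right; apply/imsetP => -[y yA].
case: tpermP => [_ ab|yE _|ya _ ay].
- by rewrite ab bB in aB.
- by rewrite yE (negPf bA) in yA.
- by case: ya.
Qed.

(** * Invariant designs *)

Section Design.
Variables (R : realFieldType) (K v S : nat).
Hypothesis hv : (2 <= v)%N.
Local Notation kap := (kap R v).

(** The set of active attributes is forced to be the set of nonzero ones, which removes the
    existential. *)
Lemma inXSE (x : pt K v) : inXS S x =
  [forall k, (x.1 k == ord0) == (x.2 k == ord0)] && (#|[set k | x.1 k != ord0]| == S).
Proof.
apply/existsP/andP => [[A /andP[/eqP cA /forallP hA]]|[/forallP h0 cS]].
  have AE : A = [set k | x.1 k != ord0].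
    apply/setP => k; rewrite inE; have := hA k.
    by case: (k \in A) => /andP[+ _]; rewrite -(inj_eq val_inj) /= => ->.
  split; last by rewrite -AE cA.
  apply/forallP => k; have := hA k; rewrite -!(inj_eq val_inj) /=.
  by case: ifP => _ /andP[]; do 2!case: eqP.
exists [set k | x.1 k != ord0]; rewrite cS; apply/forallP => k.
rewrite inE; have := h0 k; rewrite -!(inj_eq val_inj) /=.
by case: (_ == 0)%N; case: (_ == 0)%N.
Qed.

Lemma inXSd_type d (x y : pt K v) :
  (forall k, ptype v (x.1 k, x.2 k) = ptype v (y.1 k, y.2 k)) ->
  inXSd S d x = inXSd S d y.
Proof.
rewrite /inXSd !inXSE => h; congr (_ && _ && _).
- by apply: eq_forallb => k; case: (h k) => -> -> _.
- by congr (#|pred_of_set _| == _); apply/setP => k; rewrite !inE; case: (h k) => ->.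
- by congr (#|pred_of_set _| == _); apply/setP => k; rewrite !inE; case: (h k) => _ _ ->.
Qed.

Lemma inXSd_perm d (x : pt K v) (s : {perm 'I_K}) :
  inXSd S d ([ffun k => x.1 (s k)], [ffun k => x.2 (s k)]) = inXSd S d x.
Proof.
have cs (P : pred 'I_K) : #|[set k | P (s k)]| = #|[set k | P k]|.
  have -> : [set k | P (s k)] = s @^-1: [set k | P k] by apply/setP => k; rewrite !inE.
  by rewrite card_preimset //; exact: perm_inj.
rewrite /inXSd !inXSE; congr (_ && _ && _).
- apply/forallP/forallP => h k; last by rewrite !ffunE; exact: h.
  by have := h (s^-1%g k); rewrite !ffunE permKV.
- rewrite -(cs (fun k => x.1 k != ord0)); congr (#|pred_of_set _| == _).
  by apply/setP => k; rewrite !inE !ffunE.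
- rewrite -(cs (fun k => x.1 k != x.2 k)); congr (#|pred_of_set _| == _).
  by apply/setP => k; rewrite !inE !ffunE.
Qed.

Lemma invdes_type w : type_invariant R K v (invdes S w).
Proof.
by move=> x y xy; apply: eq_bigr => d _; rewrite /unif (inXSd_type _ _ _ xy).
Qed.

(** Ensures that the uniform weight is the inverse of a nonzero cardinality. *)
Lemma exists_inXSd d : (S <= K)%N -> (d <= S)%N -> exists x : pt K v, inXSd S d x.
Proof.
move=> SK dS.
(* Both profiles have level 1 on the first S attributes, except that the second has level 2,
   available as v >= 2, on the first d. *)
pose x1 : prof K v := [ffun k : 'I_K => if (k < S)%N then inord 1 else ord0].
pose x2 : prof K v :=
  [ffun k : 'I_K => if (k < d)%N then inord 2 else if (k < S)%N then inord 1 else ord0].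
have n1 : (inord 1 : 'I_v.+1) = 1%N :> nat by rewrite inordK // ltnS ltnW.
have n2 : (inord 2 : 'I_v.+1) = 2 :> nat by rewrite inordK.
have cardlt m : (m <= K)%N -> #|[set k : 'I_K | (k < m)%N]| = m.
  move=> mK; rewrite cardsE -sum1_card.
  by rewrite (big_ord_narrow mK) sum1_card card_ord.
exists (x1, x2); rewrite /inXSd inXSE /=; apply/andP; split; last first.
  rewrite -[X in _ == X](cardlt d (leq_trans dS SK)); apply/eqP; congr #|pred_of_set _|.
  apply/setP => k; rewrite !inE !ffunE -(inj_eq val_inj).
  case: (ltnP k d) => kd; first by rewrite (leq_trans kd dS) /= n1 n2.
  by rewrite eqxx.
apply/andP; split.
  apply/forallP => k; rewrite !ffunE -!(inj_eq val_inj).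
  case: (ltnP k d) => kd; first by rewrite (leq_trans kd dS) /= n1 n2.
  by rewrite eqxx.
rewrite -[X in _ == X](cardlt S SK); apply/eqP; congr #|pred_of_set _|.
apply/setP => k; rewrite !inE !ffunE -(inj_eq val_inj).
by case: (ltnP k S) => kS; rewrite //= n1.
Qed.

Lemma sum_invdes w (F : pt K v -> R) (c : nat -> R) : (S <= K)%N ->
  (forall d x, inXSd S d x -> F x = c d) ->
  \sum_x invdes S w x * F x = \sum_(1 <= d < S.+1) w d * c d.
Proof.
move=> SK Fc.
under eq_bigr => x _ do rewrite /invdes mulr_suml.
rewrite exchange_big /= big_nat [RHS]big_nat; apply: eq_bigr => d /andP[_ dS].
have [x0 x0d] := exists_inXSd d SK dS.
transitivity (\sum_(x : pt K v | inXSd S d x)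
    w d * c d * (#|[pred y : pt K v | inXSd S d y]|%:R)^-1).
  rewrite [RHS]big_mkcond; apply: eq_bigr => x _; rewrite /unif.
  by case: ifP => [/Fc ->|_]; [rewrite mulrAC | rewrite mulr0 mul0r].
rewrite sumr_const -mulrnAr -(mulr_natr (_^-1)) mulVf ?mulr1 // pnatr_eq0.
by rewrite -lt0n; apply/card_gt0P; exists x0.
Qed.

(** * Values of g_B and of the sums of q_B *)

Definition perm_pt (s : {perm 'I_K}) (x : pt K v) : pt K v :=
  ([ffun k => x.1 (s k)], [ffun k => x.2 (s k)]).

(** Permuting the attributes preserves an invariant design, and reindexing the pairs moves the
    permutation onto B. *)
Lemma block_coef_card w (A B : {set 'I_K}) : #|A| = #|B| ->
  block_coef R K v (invdes S w) A = block_coef R K v (invdes S w) B.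
Proof.
apply: tperm_invariant_card => a b {}B; set s := tperm a b.
rewrite /block_coef card_imset; last exact: perm_inj.
congr (_ / _); rewrite [RHS](reindex_inj (h := perm_pt s)) /=; last first.
  move=> x y [/ffunP e1 /ffunP e2]; rewrite [x]surjective_pairing [y]surjective_pairing.
  congr (_, _); apply/ffunP => k.
    by have := e1 (s^-1%g k); rewrite !ffunE permKV.
  by have := e2 (s^-1%g k); rewrite !ffunE permKV.
apply: eq_bigr => x _; congr (_ * _).
  by apply: eq_bigr => d _; rewrite /unif inXSd_perm.
have kp (i j : prof K v) : kprod R K v (s @: B) i j =
    kprod R K v B [ffun k => i (s k)] [ffun k => j (s k)].
  rewrite /kprod big_imset /=; last by move=> ? ? _ _; exact: perm_inj.
  by apply: eq_bigr => k _; rewrite !ffunE.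
by rewrite /qform !kp.
Qed.

(** Half the sum of q_B over the sets B of size q, for q = 1, 2, 3, at a pair differing in d
    attributes; the last branch is meant for q = 3. *)
Definition qform_sum (q d : nat) : R :=
  if q == 1%N then K%:R * h1 R K d
  else if q == 2%N then K%:R * (K%:R - 1) * h2 R K v S d
  else 2 / 3 * K%:R * (K%:R - 1) * (K%:R - 2) * h3 R K v S d.

(** Between the two profiles the kernel is 1 - 1/v at the S - d active attributes where they agree,
    -1/v at the d where they differ, and 0 elsewhere; a positive exponent keeps the zeros. *)
Lemma psum_kap d (x : pt K v) n : inXSd S d x -> (0 < n)%N ->
  [/\ psum R _ (fun k => kap (x.1 k) (x.1 k)) n = S%:R * (1 - v%:R^-1) ^+ n,
      psum R _ (fun k => kap (x.2 k) (x.2 k)) n = S%:R * (1 - v%:R^-1) ^+ n &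
      psum R _ (fun k => kap (x.1 k) (x.2 k)) n =
        (S%:R - d%:R) * (1 - v%:R^-1) ^+ n + d%:R * (- v%:R^-1) ^+ n].
Proof.
rewrite /inXSd inXSE => /andP[/andP[/forallP h0 /eqP cS] /eqP cd] n0.
have cnt (P : pred 'I_K) y : \sum_k (P k)%:R * y = #|[set k | P k]|%:R * y :> R.
  rewrite -mulr_suml -natr_sum; congr (_%:R * _).
  rewrite cardsE -sum1_card [RHS]big_mkcond; apply: eq_bigr => k _.
  by rewrite unfold_in; case: (P k).
have kap_diag (i : 'I_v.+1) : kap i i ^+ n = (i != ord0)%:R * (1 - v%:R^-1) ^+ n.
  have [->|i0] := eqVneq i ord0; last by rewrite kap_eq // mul1r.
  by rewrite kap_0l expr0n gtn_eqF // mul0r.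
split.
- by rewrite -cS -cnt; apply: eq_bigr => k _; exact: kap_diag.
- by rewrite -cS -cnt; apply: eq_bigr => k _; rewrite kap_diag -(eqP (h0 k)).
(* Every active attribute is first counted as an agreement, then those that differ are corrected. *)
- transitivity (\sum_k ((x.1 k != ord0)%:R * (1 - v%:R^-1) ^+ n +
    (x.1 k != x.2 k)%:R * ((- v%:R^-1) ^+ n - (1 - v%:R^-1) ^+ n)) : R).
    apply: eq_bigr => k _; have := h0 k.
    have [<- _|ne] := eqVneq (x.1 k) (x.2 k); first by rewrite kap_diag mul0r addr0.
    move=> /eqP e0.
    have x10 : x.1 k != ord0.
      apply: contraNneq ne => z0; rewrite z0 eq_sym.
      by rewrite -e0 z0.
    have x20 : x.2 k != ord0 by rewrite -e0.
    by rewrite kap_neq // x10 !mul1r addrC subrK.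
  rewrite big_split /= (cnt (fun k => x.1 k != ord0)) (cnt (fun k => x.1 k != x.2 k)).
  by rewrite cS cd; ring.
Qed.

(** The sum consists of elementary symmetric functions of the kernel values; Newton's identities
    express them by the power sums, which depend only on S, d and v. *)
Lemma sum_qform d (x : pt K v) q : inXSd S d x -> (3 <= K)%N -> (1 <= q <= 3)%N ->
  \sum_(B : {set 'I_K} | #|B| == q) qform R K v B x = 2 * qform_sum q d.
Proof.
move=> xd K3 q3.
have -> : \sum_(B : {set 'I_K} | #|B| == q) qform R K v B x =
    elem R _ (fun k => kap (x.1 k) (x.1 k)) q + elem R _ (fun k => kap (x.2 k) (x.2 k)) q
    - 2 * elem R _ (fun k => kap (x.1 k) (x.2 k)) q.
  by rewrite /elem mulr_sumr -big_split -sumrB.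
have K0 : K%:R != 0 :> R by rewrite pnatr_eq0 -lt0n (ltn_trans _ K3).
have K1 : K%:R - 1 != 0 :> R by apply: (natrB_neq0 R 1); exact: ltn_trans K3.
have K2 : K%:R - 2 != 0 :> R by exact: natrB_neq0.
have v0 := v_neq0 R v hv.
have [a1 b1 c1] := psum_kap d x 1 xd isT.
have [a2 b2 c2] := psum_kap d x 2 xd isT.
have [a3 b3 c3] := psum_kap d x 3 xd isT.
have [] := newton_identities R _ (fun k => kap (x.1 k) (x.1 k)); rewrite {}a1 {}a2 {}a3.
have [] := newton_identities R _ (fun k => kap (x.2 k) (x.2 k)); rewrite {}b1 {}b2 {}b3.
have [] := newton_identities R _ (fun k => kap (x.1 k) (x.2 k)); rewrite {}c1 {}c2 {}c3.
have half (y z : R) : 2 * y = z -> y = z / 2 by move=> <-; field.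
have sixth (y z : R) : 6 * y = z -> y = z / 6 by move=> <-; field.
move=> e1 /half e2 /sixth e3 f1 /half f2 /sixth f3 g1 /half g2 /sixth g3.
rewrite /qform_sum.
case: q q3 => [|[|[|[|]]]] //= _.
- by rewrite {}e1 {}f1 {}g1 /h1; field; rewrite ?K0 ?v0.
- by rewrite {}e2 {}f2 {}g2 /h2; field; rewrite ?K0 ?v0 ?K1.
- by rewrite {}e3 {}f3 {}g3 /h3 /lam; field; rewrite ?K0 ?v0 ?K1 ?K2.
Qed.

(** All sets of the same size share one coefficient, so it is their sum divided by the binomial
    coefficient, and that sum only needs [sum_qform]. *)
Lemma block_coef_value w (B : {set 'I_K}) : (S <= K)%N ->  (3 <= K)%N -> (1 <= #|B| <= 3)%N ->
  block_coef R K v (invdes S w) B = 2 * (\sum_(1 <= d < S.+1) w d * qform_sum #|B| d) /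
    ('C(K, #|B|)%:R * (v%:R - 1) ^+ #|B|).
Proof.
move=> SK K3; set q := #|B| => q3.
have BK : (q <= K)%N by have := max_card (mem B); rewrite card_ord.
have C0 : 'C(K, q)%:R != 0 :> R by rewrite pnatr_eq0 -lt0n bin_gt0.
have v1 : (v%:R - 1) ^+ q != 0 :> R by rewrite expf_neq0 ?v1_neq0.
have : \sum_(A : {set 'I_K} | #|A| == q) block_coef R K v (invdes S w) A =
   block_coef R K v (invdes S w) B *+ 'C(K, q).
  rewrite (eq_bigr (fun=> block_coef R K v (invdes S w) B)) => [|A /eqP Aq].
    rewrite sumr_const; congr (_ *+ _).
    by have := card_draws 'I_K q; rewrite card_ord => <-; rewrite cardsE.
  exact: block_coef_card.
have -> : \sum_(A : {set 'I_K} | #|A| == q) block_coef R K v (invdes S w) A =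
   2 * (\sum_(1 <= d < S.+1) w d * qform_sum q d) / (v%:R - 1) ^+ q.
  transitivity ((\sum_x invdes S w x *
      \sum_(A : {set 'I_K} | #|A| == q) qform R K v A x) / (v%:R - 1) ^+ q).
    rewrite (eq_bigr (fun x => \sum_(A : {set 'I_K} | #|A| == q)
      invdes S w x * qform R K v A x)) => [|x _]; last by rewrite mulr_sumr.
    rewrite exchange_big mulr_suml /=; apply: eq_bigr => A /eqP Aq.
    by rewrite /block_coef Aq.
  rewrite (sum_invdes w _ (fun d => 2 * qform_sum q d)) //.
    by congr (_ / _); rewrite mulr_sumr; apply: eq_bigr => d _; rewrite mulrCA.
  by move=> d x xd; exact: sum_qform.
rewrite -(mulr_natr (block_coef _ _ _ _ _)) => /esym e.
apply: (mulIf C0); rewrite {}e; move: (_ ^+ q) v1 => V v1.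
by field; rewrite v1 C0.
Qed.

Lemma sum_w_mul w (h : nat -> R) a :
  \sum_(1 <= d < S.+1) w d * (a * h d) = a * hdes S w h.
Proof. by rewrite /hdes mulr_sumr; apply: eq_bigr => d _; rewrite mulrCA. Qed.

End Design.

(** * The variance function of an invariant design *)

Theorem theorem2 (R : realFieldType) (v K S : nat)
  (hv : (2 <= v)%N) (hK : (3 <= K)%N) (hS3 : (3 <= S)%N) (hSK : (S <= K)%N)
  (w : nat -> R)
  (hw0 : forall d, (1 <= d <= S)%N -> 0 <= w d)
  (hw1 : \sum_(1 <= d < S.+1) w d = 1)
  (hh1 : 0 < hdes S w (h1 R K))
  (hh2 : 0 < hdes S w (h2 R K v S))
  (hh3 : 0 < hdes S w (h3 R K v S)) :
  infomx (invdes (K:=K) (v:=v) S w) \in unitmx /\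
  forall (d : nat) (x : pt K v), (1 <= d <= S)%N -> inXSd S d x ->
    varf (invdes S w) x = Vformula K v S w d.
Proof.
have xiT := invdes_type R K v S w.
have K0 : K%:R != 0 :> R by rewrite pnatr_eq0 -lt0n (ltn_trans _ hK).
have K1 : K%:R - 1 != 0 :> R by apply: (natrB_neq0 R 1); exact: ltn_trans hK.
have K2 : K%:R - 2 != 0 :> R by exact: natrB_neq0.
have v0 := v_neq0 R v hv; have v1 := v1_neq0 R v hv.
pose H q := if q == 1%N then hdes S w (h1 R K)
  else if q == 2%N then hdes S w (h2 R K v S) else hdes S w (h3 R K v S).
have H0 q : H q != 0 by rewrite /H; case: ifP => _; [|case: ifP => _]; rewrite lt0r_neq0.
(* The factors in K from [qform_sum] cancel against the binomial coefficient and leave 2^q in all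
   three cases. *)
have cH (B : {set 'I_K}) : (0 < #|B| <= 3)%N ->
    block_coef R K v (invdes S w) B = (2 / (v%:R - 1)) ^+ #|B| * H #|B|.
  move=> B3; rewrite block_coef_value //; move: B3; rewrite /qform_sum /H.
  case: #|B| => [|[|[|[|]]]] //= _.
  - by rewrite (sum_w_mul R S w _ K%:R) bin1; field; rewrite ?K0 ?v1.
  - by rewrite sum_w_mul natr_bin2; field; rewrite ?K0 ?K1 ?v1.
  - by rewrite sum_w_mul natr_bin3; field; rewrite ?K0 ?K1 ?K2 ?v1.
have c0 (B : {set 'I_K}) : (0 < #|B| <= 3)%N -> block_coef R K v (invdes S w) B != 0.
  by move=> B3; rewrite cH // mulf_neq0 // expf_neq0 // mulf_neq0 ?invr_eq0 ?pnatr_eq0.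
split; first exact: infomx_unit.
move=> d x _ xd; rewrite (varfE R K v hv) //.
(* The denominator now depends only on the size of B, so the sets are sorted by size and [sum_qform]
   applies to each class. *)
have -> : \sum_(B : {set 'I_K} | (0 < #|B| <= 3)%N) qform R K v B x /
      block_coef R K v (invdes S w) B =
    \sum_(1 <= q < 4) 2 * qform_sum R K v S q d / ((2 / (v%:R - 1)) ^+ q * H q).
  rewrite (eq_bigr (fun B : {set 'I_K} => \sum_(1 <= q < 4)
    (if #|B| == q then qform R K v B x / ((2 / (v%:R - 1)) ^+ q * H q) else 0))).
    rewrite exchange_big /= big_nat [RHS]big_nat; apply: eq_bigr => q q3.
    rewrite -(sum_qform R K v S hv d x) // mulr_suml -big_mkcondr /=.
    by apply: eq_bigl => B; case: eqP => [->|]; rewrite ?andbF // q3.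
  move=> B B3; rewrite cH //.
  do 3!rewrite big_ltn //; rewrite big_geq //.
  by case: #|B| B3 => [|[|[|[|]]]] //= _; rewrite !(addr0, add0r).
do 3!rewrite big_ltn //; rewrite big_geq // addr0.
have := H0 1%N; have := H0 2; have := H0 3.
rewrite /qform_sum /H /= /Vformula.
(* The rest is a rational identity in which the three averages are arbitrary nonzero numbers. *)
move: (hdes _ _ _) (hdes _ _ _) (hdes _ _ _) => A B C C0 B0 A0.
rewrite /h1 /h2 /h3.
by field; rewrite ?v0 ?v1 ?A0 ?B0 ?C0 ?K0 ?K1 ?K2.
Qed.
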